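(* Consider the beacon model of linear search in which the robot moves with speed $1$ when moving away from the origin and with constant speed $s>1$ when moving towards the origin. Let $D=\{1,2,2^2,\ldots\}$ be the doubling strategy ($x_k=2^{k-1}$). Then $$\sigma^* = \sigma_D = 5+\frac{4}{s}.$$
   Context: A robot starts at the origin of the real line and searches for a stationary target at an unknown point at distance $d$ from the origin (on either side). A zig-zag strategy is an infinite sequence $X=\{x_k\}_{k\ge1}$ of positive reals with $x_k<x_{k+2}$ for all $k$; the zig-zag search with strategy $X$ proceeds in rounds $k=1,2,\dots$: in an odd (resp. even) round the robot moves right (resp. left) from the origin a distance $x_k$, stopping if it reaches the target, and otherwise turns and returns to the origin. $\sigma_X(d)$ denotes the ratio between the time the robot using $X$ needs to reach a target at distance $d$ (worst case over the target being at $+d$ or $-d$) and the time an omniscient robot, knowing the target's location and obeying the same movement rules, needs to travel from the origin directly to the target. The competitive ratio is $\sigma_X=\sup_{d>1}\sigma_X(d)$, and $\sigma^*$ denotes the optimal (infimum over all strategies) competitive ratio. *)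

(* Defs.v *)
From HB Require Import structures.
From mathcomp Require Import all_boot all_order all_algebra.
From mathcomp Require Import all_classical all_reals all_analysis.

Set Implicit Arguments.
Unset Strict Implicit.
Unset Printing Implicit Defensive.

Import Order.TTheory GRing.Theory Num.Theory.

Local Open Scope classical_set_scope.
Local Open Scope ring_scope.

(* Throughout, [vout] is the speed when moving away from the origin and [vin]
   the speed when moving towards it; the right half-line is the positive one. *)

(* Rounds are numbered from 1, so the value [X 0] plays no role. *)
Definition zigzag (R : realType) (X : nat -> R) : Prop :=
  forall k : nat, (0 < k)%N -> 0 < X k /\ X k < X k.+2.

Definition direction (R : realType) (k : nat) : R := if odd k then 1 else -1.

(* The time at which round [k] starts; each earlier round [i] covers the
   distance [X i] once outwards and once back. *)
Definition round_start (R : realType) (vout vin : R) (X : nat -> R) (k : nat)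
  : R := \sum_(1 <= i < k) (X i / vout + X i / vin).

(* The zig-zag search passes through the point [p] at time [t]. During round
   [k] it is at distance [u] from the origin once on the way out and once on the
   way back (the two times coincide at the turning point [u = X k]). *)
Definition visits (R : realType) (vout vin : R) (X : nat -> R) (t p : R)
  : Prop :=
  exists k : nat, (0 < k)%N /\ exists u : R,
    [/\ 0 <= u <= X k,
        p = direction R k * u &
        t = round_start vout vin X k + u / vout \/
        t = round_start vout vin X k + X k / vout + (X k - u) / vin].

(* First time at which the target [p] is reached, [+oo] if it never is. *)
Definition search_time (R : realType) (vout vin : R) (X : nat -> R) (p : R)
  : \bar R := ereal_inf [set t%:E | t in [set t | visits vout vin X t p]].

(* The omniscient robot goes straight to the target, always moving outwards. *)
Definition omniscient_time (R : realType) (vout d : R) : R := d / vout.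

Definition ratio_at (R : realType) (vout vin : R) (X : nat -> R) (d : R)
  : \bar R :=
  (Order.max (search_time vout vin X d) (search_time vout vin X (- d))
   / (omniscient_time vout d)%:E)%E.

Definition competitive_ratio (R : realType) (vout vin : R) (X : nat -> R)
  : \bar R := ereal_sup [set ratio_at vout vin X d | d in [set d | 1 < d]].

Definition optimal_ratio (R : realType) (vout vin : R) : \bar R :=
  ereal_inf [set competitive_ratio vout vin X | X in [set X | zigzag X]].

Definition doubling (R : realType) (k : nat) : R := 2 ^+ k.-1.

Lemma doubling_zigzag (R : realType) : zigzag (@doubling R).
Proof.
case=> [//|k] _; split; first exact: exprn_gt0.
by rewrite /doubling /= ltr_eXn2l ?ltr1n.
Qed.

(* Main.v *)
Require Import Defs.
From mathcomp Require Import all_boot all_order all_algebra.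
From mathcomp Require Import all_classical all_reals all_analysis.
From mathcomp Require Import zify ring lra.

Import Order.TTheory GRing.Theory Num.Theory.
Local Open Scope ring_scope.

(** Put [c = 1 + 1/s] and [S k = x_1 + ... + x_k].  A target at distance [d > x_k]
    on the side visited in round [k] is not reached before time
    [c * S (k+1) + d].  So if the competitive ratio were less than [1 + 4 c],
    there would be some [r < 4] such that [S (k+1) <= r * x_k] for all large [k].
    With [x_k = S k - S (k-1)] and [4 (a - b) b <= a^2] this gives
    [S (k+1) / S k <= (r / 4) * (S k / S (k-1))], so the quotients
    [S (k+1) / S k > 1] would tend to [0].  For the doubling strategy,
    [S (k+1) <= 4 * x_k], which gives the matching upper bound. *)

(** * Growth of sequences of partial sums *)

Lemma ratio_bound_ge4 {R : realType} (T : nat -> R) (r : R) :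
  (forall n, 0 < T n < T n.+1) ->
  (forall n, T n.+2 <= r * (T n.+1 - T n)) -> 4 <= r.
Proof.
move=> T_incr T_le; rewrite leNgt; apply/negP => r_lt4.
have T_gt0 n : 0 < T n by case/andP: (T_incr n).
have T_lt n : T n < T n.+1 by case/andP: (T_incr n).
have r_gt0 : 0 < r.
  rewrite -(pmulr_lgt0 r (_ : 0 < T 1 - T 0)) ?subr_gt0//.
  exact: lt_le_trans (T_gt0 2) (T_le 0).
pose q := r / 4; pose a := T 1 / T 0.
have q_gt0 : 0 < q by rewrite divr_gt0.
have a_gt0 : 0 < a by rewrite divr_gt0.
(* Each step multiplies the bound on [T n.+1 / T n] by [q], starting from the first quotient [a]. *)
have T_geo n : T n.+1 <= q ^+ n * a * T n.
  elim: n => [|n IHn]; first by rewrite mul1r divfK ?gt_eqF.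
  have gap : 4 * (T n.+1 - T n) <= q ^+ n * a * T n.+1.
    rewrite -(ler_pM2r (T_gt0 n)) (@le_trans _ _ (T n.+1 * T n.+1))//.
      by have := sqr_ge0 (T n.+1 - 2 * T n); nra.
    by rewrite mulrAC ler_pM2r.
  apply: le_trans (T_le n) _.
  have -> : r * (T n.+1 - T n) = q * (4 * (T n.+1 - T n)) by rewrite /q; field.
  have -> : q ^+ n.+1 * a * T n.+1 = q * (q ^+ n * a * T n.+1).
    by rewrite exprS; ring.
  by rewrite ler_pM2l.
have q_lt1 : `|q| < 1 by rewrite gtr0_norm// ltr_pdivrMr// mul1r.
have ainv_gt0 : 0 < a^-1 by rewrite invr_gt0.
(* Once [q ^+ N < a^-1], the bound gives [T N.+1 <= T N], against strict growth. *)
have /cvgrPdist_lt/(_ _ ainv_gt0) [N _ /(_ N (leqnn N))] := cvg_expr q_lt1.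
rewrite /= sub0r normrN gtr0_norm ?exprn_gt0// -(ltr_pM2r a_gt0).
rewrite mulVf ?gt_eqF// => qa_lt1.
have := T_lt N; rewrite ltNge (le_trans (T_geo N))//.
by rewrite ger_pMl// ltW.
Qed.

Section LinearSearch.
Context {R : realType} {s : R}.
Hypothesis s_gt0 : 0 < s.
Implicit Types (X : nat -> R) (d t p : R) (k : nat).

(** Like [round_start], the sum stops before [k]: for [k > 0] it is [S (k-1)] in the notation
    above. *)
Definition excursion_sum X k : R := \sum_(1 <= i < k) X i.

Lemma round_startE X k :
  round_start 1 s X k = (1 + s^-1) * excursion_sum X k.
Proof.
by rewrite mulr_sumr; apply: eq_bigr => i _; rewrite divr1 mulrDl mul1r mulrC.
Qed.

Lemma excursion_sumS X k :
  (0 < k)%N -> excursion_sum X k.+1 = excursion_sum X k + X k.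
Proof. by move=> k_gt0; rewrite /excursion_sum big_nat_recr. Qed.

Lemma cost_gt0 : 0 < 1 + s^-1.
Proof. by rewrite addr_gt0// invr_gt0. Qed.

(** * Lower bound for arbitrary zig-zag strategies *)

Section Zigzag.
Variable X : nat -> R.
Hypothesis zX : zigzag X.

Lemma zigzag_gt0 k : (0 < k)%N -> 0 < X k.
Proof. by case/zX. Qed.

Lemma zigzag_le_same_side j k :
  (0 < j <= k)%N -> odd j = odd k -> X j <= X k.
Proof.
move=> /andP[j_gt0 jk] odd_jk.
have -> : k = (j + (k - j)./2.*2)%N by lia.
elim: (k - j)./2 => [|n IHn]; first by rewrite addn0.
apply: le_trans IHn _; rewrite doubleS !addnS ltW//.
by case: (zX (j + n.*2)) => //; lia.
Qed.

Lemma excursion_sum_lt k :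
  (0 < k)%N -> excursion_sum X k < excursion_sum X k.+1.
Proof. by move=> k_gt0; rewrite excursion_sumS// ltrDl zigzag_gt0. Qed.

Lemma excursion_sum_le j k :
  (0 < j <= k)%N -> excursion_sum X j <= excursion_sum X k.
Proof.
move=> /andP[j_gt0 /subnKC <-].
elim: (k - j)%N => [|n IHn]; first by rewrite addn0.
by rewrite addnS (le_trans IHn)// ltW// excursion_sum_lt//; lia.
Qed.

(** Distances increase on each side, so every term is at least the smaller of the first two and the
    sums grow at least linearly. *)
Lemma excursion_sum_unbounded (B : R) :
  exists2 N : nat, (1 < N)%N & B < excursion_sum X N.
Proof.
pose m := Num.min (X 1) (X 2).
have m_gt0 : 0 < m by rewrite lt_min !zigzag_gt0.
have m_le k : (0 < k)%N -> m <= X k.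
  move=> k_gt0; case: (boolP (odd k)) => odd_k.
    by rewrite ge_min zigzag_le_same_side// odd_k.
  by rewrite ge_min orbC zigzag_le_same_side//=; lia.
have sum_ge n : m * n%:R <= excursion_sum X n.+1.
  elim: n => [|n IHn]; first by rewrite mulr0 /excursion_sum big_geq.
  by rewrite excursion_sumS// -natr1 mulrDr mulr1 lerD// m_le.
exists (Num.truncn (B / m)).+3 => //.
apply: lt_le_trans (sum_ge _).
rewrite mulrC -ltr_pdivrMr//; apply: lt_le_trans (truncnS_gt _) _.
by rewrite ler_nat.
Qed.

(** Rounds up to [k] on this side fall short of [d], and round [k+1] goes the other way, so round
    [k+2] is the earliest that can reach the target. *)
Lemma search_time_ge k d : (0 < k)%N -> X k < d ->
  (((1 + s^-1) * excursion_sum X k.+2 + d)%:E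
     <= search_time 1 s X (direction R k * d))%E.
Proof.
move=> k_gt0 Xk_lt; apply: le_ereal_inf_tmp => _ [t [j [j_gt0 [u +]]] <-].
case=> /andP[u_ge0 u_le] p_eq t_eq; rewrite lee_fin.
have d_gt0 : 0 < d := lt_trans (zigzag_gt0 k k_gt0) Xk_lt.
have [odd_jk ud] : odd j = odd k /\ u = d.
  by move: p_eq; rewrite /direction; case: (odd j); case: (odd k) => p_eq;
    split=> //; lra.
have k2_le : (k.+2 <= j)%N.
  rewrite leqNgt; apply/negP => j_lt.
  have : X j <= X k by apply: zigzag_le_same_side => //; lia.
  by rewrite -ud in Xk_lt; lra.
have sum_le : (1 + s^-1) * excursion_sum X k.+2 <= round_start 1 s X j.
  by rewrite round_startE ler_pM2l ?cost_gt0// excursion_sum_le.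
have back_ge0 : 0 <= (X j - u) / s by rewrite divr_ge0 ?subr_ge0// ltW.
by case: t_eq; rewrite divr1; lra.
Qed.

Lemma ratio_at_ge k d : (0 < k)%N -> 1 < d -> X k < d ->
  (((1 + s^-1) * excursion_sum X k.+2 / d + 1)%:E <= ratio_at 1 s X d)%E.
Proof.
move=> k_gt0 d_gt1 Xk_lt; have d_gt0 : 0 < d by lra.
rewrite /ratio_at /omniscient_time divr1 inver gt_eqF// lee_pdivlMr//.
rewrite -EFinM mulrDl divfK ?gt_eqF// mul1r le_max.
have := search_time_ge k d k_gt0 Xk_lt; rewrite /direction.
by case: (odd k); rewrite ?mulN1r ?mul1r => ->; rewrite ?orbT.
Qed.

Lemma zigzag_competitive_ratio_ge :
  ((5 + 4 / s)%:E <= competitive_ratio 1 s X)%E.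
Proof.
rewrite leNgt; apply/negP => cr_lt.
have [M cr_le M_lt] : exists2 M : R,
    (competitive_ratio 1 s X <= M%:E)%E & M < 5 + 4 / s.
  case: (competitive_ratio 1 s X) cr_lt => [m||]//.
    by rewrite lte_fin => m_lt; exists m.
  (* For the value [-oo], any real below the bound serves as [M]. *)
  by exists 0; rewrite ?leNye// addr_gt0// divr_gt0.
pose c := 1 + s^-1; have c_gt0 : 0 < c := cost_gt0.
(* Solving [c * S / d + 1 <= M] for [S] gives [S <= r * d]; [r < 4] because
   [5 + 4 / s = 1 + 4 * c]. *)
pose r := (M - 1) / c.
have r_lt4 : r < 4 by rewrite ltr_pdivrMr// /c; lra.
have sum_le_dist k d : (0 < k)%N -> 1 < d -> X k < d ->
    excursion_sum X k.+2 <= r * d.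
  move=> k_gt0 d_gt1 Xk_lt; have d_gt0 : 0 < d by lra.
  have : (ratio_at 1 s X d <= M%:E)%E.
    by apply: le_trans cr_le; apply: ereal_sup_ubound; exists d.
  move/(le_trans (ratio_at_ge k d k_gt0 d_gt1 Xk_lt)).
  rewrite lee_fin -lerBrDr ler_pdivrMr// => le_M.
  by rewrite /r mulrAC ler_pdivlMr// mulrC.
(* Let [d] decrease to the excluded endpoint [max 1 (X k)]; since [r < 4], the offset [e / 4] costs
   at most [e]. *)
have sum_le_max k : (0 < k)%N -> excursion_sum X k.+2 <= r * Num.max 1 (X k).
  move=> k_gt0; set m := Num.max 1 (X k).
  have m_ge : 1 <= m /\ X k <= m by rewrite /m !le_max !lexx orbT.
  apply/ler_addgt0Pr => e e_gt0.
  apply: le_trans (sum_le_dist k (m + e / 4) k_gt0 _ _) _; [lra|lra|].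
  by rewrite mulrDr lerD2l; nra.
(* Beyond this [N] the sums exceed [r], so [X k < 1] would contradict [sum_le_max], and the maximum
   is [X k]. *)
have [N N_gt1 r_lt_sum] := excursion_sum_unbounded r.
have X_ge1 k : (N <= k)%N -> 1 <= X k.
  move=> Nk; rewrite leNgt; apply/negP => Xk_lt1.
  have := sum_le_max k ltac:(lia); rewrite (max_l (ltW Xk_lt1)) mulr1.
  have : excursion_sum X N <= excursion_sum X k.+2.
    by apply: excursion_sum_le; lia.
  by lra.
suff : 4 <= r by lra.
apply: (ratio_bound_ge4 (fun n => excursion_sum X (N + n))) => n /=.
  rewrite addnS excursion_sum_lt ?andbT; last by lia.
  apply: (@lt_le_trans _ _ (excursion_sum X 2)).
    by rewrite /excursion_sum big_nat1 zigzag_gt0.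
  by apply: excursion_sum_le; lia.
rewrite !addnS [in X in _ <= r * X]excursion_sumS; last by lia.
rewrite addrC addKr.
by have := sum_le_max (N + n)%N ltac:(lia); rewrite max_r// X_ge1// leq_addr.
Qed.

End Zigzag.

(** * Upper bound for the doubling strategy *)

Lemma search_time_le X k d : (0 < k)%N -> 0 <= d <= X k ->
  (search_time 1 s X (direction R k * d)
     <= ((1 + s^-1) * excursion_sum X k + d)%:E)%E.
Proof.
move=> k_gt0 d_le; apply: ereal_inf_lbound.
exists ((1 + s^-1) * excursion_sum X k + d) => //.
by exists k; split=> //; exists d; split=> //; left; rewrite round_startE divr1.
Qed.

Lemma doubling_sum k : excursion_sum (@doubling R) k.+1 = 2 ^+ k - 1.
Proof.
elim: k => [|k IHk]; first by rewrite /excursion_sum big_geq// subrr.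
by rewrite excursion_sumS// IHk /doubling /= exprS; ring.
Qed.

Lemma pow2_bracket d :
  1 < d -> exists n : nat, (2 : R) ^+ n < d <= 2 ^+ n.+1.
Proof.
move=> d_gt1; have d_le_pow : exists n : nat, d <= (2 : R) ^+ n.
  exists (Num.truncn d).+1; apply: ltW; apply: lt_le_trans (truncnS_gt _) _.
  by rewrite -natrX ler_nat ltnW// ltn_expl.
case: (ex_minnP d_le_pow) => -[|n] d_le n_min; first by move: d_le; lra.
exists n; rewrite d_le andbT ltNge; apply/negP => /n_min.
by rewrite ltnn.
Qed.

(** The excursions before round [n+3] sum to [2 ^+ (n+2) - 1], which is less than [4 * d]. *)
Lemma doubling_search_time_le n j d :
  (2 : R) ^+ n < d -> d <= doubling R j -> (0 < j <= n.+3)%N ->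
  (search_time 1 s (@doubling R) (direction R j * d)
     <= ((5 + 4 / s) * d)%:E)%E.
Proof.
move=> n_lt d_le /andP[j_gt0 j_le].
have pow_gt0 : 0 < (2 : R) ^+ n by rewrite exprn_gt0.
apply: le_trans (search_time_le _ j d j_gt0 _) _; first by rewrite d_le andbT; lra.
have sum_le : excursion_sum (@doubling R) j <= 4 * d.
  apply: le_trans (excursion_sum_le _ (@doubling_zigzag R) j n.+3 _) _; first by lia.
  by rewrite doubling_sum !exprS; lra.
rewrite lee_fin.
have -> : (5 + 4 / s) * d = (1 + s^-1) * (4 * d) + d by ring.
by rewrite lerD2r ler_pM2l ?cost_gt0.
Qed.

Lemma doubling_competitive_ratio_le :
  (competitive_ratio 1 s (@doubling R) <= (5 + 4 / s)%:E)%E.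
Proof.
apply: ge_ereal_sup => _ [d d_gt1 <-]; have d_gt0 : 0 < d by move: d_gt1 => /=; lra.
have [n /andP[n_lt d_le]] := pow2_bracket d d_gt1.
(* Rounds [n+2] and [n+3] both reach distance [d], on opposite sides, so they cover both target
   positions. *)
have time2 := doubling_search_time_le n n.+2 d n_lt d_le ltac:(lia).
have time3 : (search_time 1 s (@doubling R) (direction R n.+3 * d)
    <= ((5 + 4 / s) * d)%:E)%E.
  apply: (doubling_search_time_le n) => //; last by rewrite leqnn.
  apply: le_trans d_le _.
  by rewrite /doubling ler_eXn2l ?ltr1n.
rewrite /ratio_at /omniscient_time divr1 inver gt_eqF// lee_pdivrMr// -EFinM ge_max.
move: time2 time3; rewrite /direction /= !negbK.
by case: (odd n); rewrite /= ?mulN1r ?mul1r => -> ->.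
Qed.

End LinearSearch.

Theorem theorem2 (R : realType) (s : R) (hs : 1 < s) :
  optimal_ratio 1 s = competitive_ratio 1 s (@doubling R) /\
  competitive_ratio 1 s (@doubling R) = (5 + 4 / s)%:E.
Proof.
have s_gt0 : 0 < s by lra.
have doublingE : competitive_ratio 1 s (@doubling R) = (5 + 4 / s)%:E.
  apply/eqP; rewrite eq_le doubling_competitive_ratio_le//.
  by rewrite zigzag_competitive_ratio_ge//; exact: doubling_zigzag.
split=> //; apply/eqP; rewrite eq_le; apply/andP; split.
  by apply: ereal_inf_lbound; exists (@doubling R) => //; exact: doubling_zigzag.
rewrite doublingE; apply: le_ereal_inf_tmp => _ [X zX <-].
exact: zigzag_competitive_ratio_ge.
Qed.
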